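(* Let $G$ be a group and $N$ a normal subgroup of $G$. For every $x\in[G,N]$, $$\mathrm{fill}_{G,N}(x)=4\cdot\mathrm{scl}_{G,N}(x).$$
   Context: Commutators are $[g,h]=ghg^{-1}h^{-1}$. A $(G,N)$-commutator is an element $[g,h]$ with $g\in G$, $h\in N$; $[G,N]$ is the subgroup they generate. For $x\in[G,N]$, $\mathrm{cl}_{G,N}(x)$ is the minimal $n\ge0$ such that $x$ is a product of $n$ $(G,N)$-commutators, and $\mathrm{scl}_{G,N}(x)=\lim_{n\to\infty}\mathrm{cl}_{G,N}(x^n)/n$. Let $C_n(G)$ be the real vector space with basis $G^n$, and $\partial\colon C_2(G)\to C_1(G)$ the linear map with $\partial(g_1,g_2)=g_2-g_1g_2+g_1$. Let $C_2'\subset C_2(G)$ be the subspace spanned by the pairs $(g_1,g_2)$ with $g_1\in N$ or $g_2\in N$, with the $\ell^1$-norm $\|\cdot\|_1$ with respect to this basis; let $Z_2'=C_2'\cap\ker\partial$ and $B_1'=\partial C_2'\subset C_1(G)$. $B_1'$ carries the norm transported from the quotient norm by $C_2'/Z_2'\cong B_1'$, i.e. $\|b\|'=\inf\{\|c\|_1 : c\in C_2',\ \partial c=b\}$. Every $x\in[G,N]$, regarded as a basis element of $C_1(G)$, lies in $B_1'$, and the $(G,N)$-filling norm is $\mathrm{fill}_{G,N}(x)=\lim_{n\to\infty}\|x^n\|'/n$ (the limit exists; here $x^n$ is the basis element corresponding to the group element $x^n$). *)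

(* Defs.v *)
From mathcomp Require Import all_boot all_order all_algebra finmap.
From mathcomp Require Import all_classical all_reals topology normedtype sequences.
(* The notations of monalg clash with those of mathcomp-analysis, so its
   identifiers are used bare: malg K R is the free R-module on K, mkmalgU k a
   is a times the basis element k, mcoeff k c is the coefficient of c at k and
   msupp c is the finite support of c. *)
From mathcomp Require Import -(notations) monalg.

Set Implicit Arguments.
Unset Strict Implicit.
Unset Printing Implicit Defensive.

Import Order.TTheory GRing.Theory Num.Theory.
Import numFieldNormedType.Exports.

Local Open Scope classical_set_scope.
Local Open Scope ring_scope.

Definition normal_subgroup (G : groupType) (N : set G) : Prop :=
  group_closed [in N] /\ forall g h : G, N h -> N (g * h * g^-1)%g.

(* [g, h] = g h g^-1 h^-1, whereas the library's [~ g, h] is g^-1 h^-1 g h. *)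
Definition comm (G : groupType) (g h : G) : G := (g * h * g^-1 * h^-1)%g.

Definition mixed_comm (G : groupType) (N : set G) : set G :=
  [set y | exists g h : G, N h /\ y = comm g h].

Definition generated_subgroup (G : groupType) (S : set G) : set G :=
  smallest (fun H : set G => group_closed [in H]) S.

Definition mixed_comm_subgroup (G : groupType) (N : set G) : set G :=
  generated_subgroup (mixed_comm N).

Definition prod_of_mixed_comms (G : groupType) (N : set G) (x : G) (n : nat) :
    Prop :=
  exists s : n.-tuple G,
    (forall y, y \in s -> mixed_comm N y) /\ x = (\prod_(y <- s) y)%g.

(* The least n such that x is a product of n mixed commutators; the default
   value 0 is only reached outside the mixed commutator subgroup. *)
Definition cl (G : groupType) (N : set G) (x : G) : nat :=
  xget 0%N [set n | prod_of_mixed_comms N x n /\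
                    forall m, prod_of_mixed_comms N x m -> (n <= m)%N].

Definition scl (R : realType) (G : groupType) (N : set G) (x : G) : R :=
  limn (fun n : nat => (cl N (x ^+ n)%g)%:R / n%:R : R).

Section Chains.
Context {R : realType} {G : groupType}.

Local Notation chain1 := (malg G R).
Local Notation chain2 := (malg (G * G)%type R).

Definition basis1 (g : G) : chain1 := mkmalgU g 1.
Definition basis2 (g1 g2 : G) : chain2 := mkmalgU (g1, g2) 1.

Definition boundary (c : chain2) : chain1 :=
  \sum_(p <- msupp c)
    mcoeff p c *: (basis1 p.2 - basis1 (p.1 * p.2)%g + basis1 p.1).

Definition norm1 (c : chain2) : R := \sum_(p <- msupp c) `|mcoeff p c|.

Definition linear_span (V : lmodType R) (S : set V) : set V :=
  smallest (fun W : set V => GRing.submod_closed [in W]) S.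

Definition mixed_chain2 (N : set G) : set chain2 :=
  linear_span [set c | exists g1 g2 : G, (N g1 \/ N g2) /\ c = basis2 g1 g2].

(* The quotient norm on mixed_chain2 N modulo cycles, transported to the image
   of the boundary; the value is junk outside that image. *)
Definition mixed_norm (N : set G) (b : chain1) : R :=
  inf [set norm1 c | c in [set c | mixed_chain2 N c /\ boundary c = b]].

End Chains.

Definition fill (R : realType) (G : groupType) (N : set G) (x : G) : R :=
  limn (fun n : nat => mixed_norm N (basis1 (x ^+ n)%g) / n%:R : R).

(* Main.v *)
(* Triangulating the surface of a product of [n] mixed commutators gives
   [||x|| <= 4 n + 1], hence [fill <= 4 scl].
   For the other inequality, a real filling of [y] yields, after simultaneous
   rational approximation, an integral filling of [M y] by [K] triangles having
   an edge in [N]. Glue the triangles along equal edges: first along edges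
   outside [N], which gives strips and annuli whose boundary edges lie in [N],
   then along edges in [N]. Counting with Euler characteristic, the glued
   surface writes [y ^ M] as a product of at most [K / 4 + 2 M] mixed
   commutators; all of them are mixed because every handle is created along an
   edge in [N]. Applied to [y = x ^ n], the error [2 M] is negligible after
   dividing by [n M] and letting [n] grow. *)
Require Import Defs.
From mathcomp Require Import all_boot all_order all_algebra finmap.
From mathcomp Require Import all_classical all_reals topology normedtype sequences.
From mathcomp Require Import -(notations) monalg.
From mathcomp Require Import zify ring lra.

Set Implicit Arguments.
Unset Strict Implicit.
Unset Printing Implicit Defensive.

Import Order.TTheory GRing.Theory Num.Theory.
Import numFieldNormedType.Exports.

Local Open Scope classical_set_scope.
Local Open Scope ring_scope.

Ltac gnorm := rewrite ?(invgM, invgK, invg1, mulgA, mul1g, mulg1, mulgV, mulVg,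
  mulgK, mulgVK, mulg1, mul1g).

(** * Closure properties of products of mixed commutators *)

Section MixedCommutators.
Context {G : groupType} {N : set G} (hN : normal_subgroup N).
Local Open Scope group_scope.

Lemma normal1 : N 1.
Proof. by case: hN => -[/set_mem]. Qed.

Lemma normalM g h : N g -> N h -> N (g * h).
Proof.
by case: hN => /group_closedM NM _ Ng Nh; apply/set_mem/NM; apply/mem_set.
Qed.

Lemma normalV g : N g -> N g^-1.
Proof. by case: hN => /group_closedV NV _ Ng; apply/set_mem/NV/mem_set. Qed.

Lemma normalJ g h : N h -> N (g * h * g^-1).
Proof. by case: hN => _; apply. Qed.

Lemma normalX g n : N g -> N (g ^+ n).
Proof.
by move=> Ng; elim: n => [|n IH]; [exact: normal1 | rewrite expgS; apply: normalM].
Qed.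

Lemma normal_mulr g h : N h -> N (g * h) <-> N g.
Proof.
move=> Nh; split=> [Ngh|/normalM]; last exact.
by rewrite -(mulgK h g); apply: normalM => //; apply: normalV.
Qed.

Lemma normal_mull g h : N g -> N (g * h) <-> N h.
Proof.
move=> Ng; split=> [Ngh|]; last exact: normalM.
by rewrite -(mulKg g h); apply: normalM => //; apply: normalV.
Qed.

Lemma mixed_commJ k y : mixed_comm N y -> mixed_comm N (k * y * k^-1).
Proof.
move=> [g [h [Nh ->]]]; exists (k * g * k^-1), (k * h * k^-1).
by split; [exact: normalJ | rewrite /comm; gnorm].
Qed.

Lemma mixed_comm_swap g h : N h -> mixed_comm N (h * g * h^-1 * g^-1).
Proof.
move=> Nh; have -> : h * g * h^-1 * g^-1 = h * comm g h^-1 * h^-1.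
  by rewrite /comm; gnorm.
by apply: mixed_commJ; exists g, h^-1; split=> //; apply: normalV.
Qed.

Lemma mixed_commV y : mixed_comm N y -> mixed_comm N y^-1.
Proof.
move=> [g [h [Nh ->]]]; have -> : (comm g h)^-1 = h * g * h^-1 * g^-1.
  by rewrite /comm; gnorm.
exact: mixed_comm_swap.
Qed.

Lemma mixed_comm_normal y : mixed_comm N y -> N y.
Proof.
by move=> [g [h [Nh ->]]]; apply: normalM (normalV Nh); apply: normalJ.
Qed.

Lemma mixed_comm1 : mixed_comm N 1.
Proof. by exists 1, 1; split; [exact: normal1 | rewrite /comm; gnorm]. Qed.

Lemma prod_of_mixed_comms0 : prod_of_mixed_comms N 1 0.
Proof. by exists [tuple]; split=> //; rewrite big_nil. Qed.

Lemma prod_of_mixed_comms1 y : mixed_comm N y -> prod_of_mixed_comms N y 1.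
Proof.
move=> Ny; exists [tuple y]; split=> [z|]; last by rewrite big_seq1.
by rewrite inE => /eqP->.
Qed.

Lemma prod_of_mixed_commsM x y m n :
  prod_of_mixed_comms N x m -> prod_of_mixed_comms N y n ->
  prod_of_mixed_comms N (x * y) (m + n).
Proof.
move=> [s [Ns ->]] [t [Nt ->]]; exists [tuple of s ++ t].
by split=> [z|]; [rewrite mem_cat => /orP[/Ns|/Nt] | rewrite big_cat].
Qed.

Lemma prod_of_mixed_comms_ind (P : G -> nat -> Prop) :
  P 1 0 -> (forall x y n, mixed_comm N x -> P y n -> P (x * y) n.+1) ->
  forall x n, prod_of_mixed_comms N x n -> P x n.
Proof.
move=> P0 PS x n [s [Ns ->]]; elim: n s Ns => [|n IH] s Ns.
  by rewrite tuple0 big_nil.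
case/tupleP: s Ns => y s Ns; rewrite big_cons; apply: PS.
  by apply: Ns; rewrite mem_head.
by apply: IH => z sz; apply: Ns; rewrite inE sz orbT.
Qed.

Lemma prod_of_mixed_commsJ g x n :
  prod_of_mixed_comms N x n -> prod_of_mixed_comms N (g * x * g^-1) n.
Proof.
move: x n; apply: prod_of_mixed_comms_ind => [|x y n Nx IH].
  by gnorm; apply: prod_of_mixed_comms0.
have -> : g * (x * y) * g^-1 = (g * x * g^-1) * (g * y * g^-1) by gnorm.
rewrite -add1n; apply: prod_of_mixed_commsM => //.
by apply: prod_of_mixed_comms1; apply: mixed_commJ.
Qed.

Lemma prod_of_mixed_commsV x n :
  prod_of_mixed_comms N x n -> prod_of_mixed_comms N x^-1 n.
Proof.
move: x n; apply: prod_of_mixed_comms_ind => [|x y n Nx IH].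
  by rewrite invg1; apply: prod_of_mixed_comms0.
rewrite invgM -addn1; apply: prod_of_mixed_commsM => //.
by apply: prod_of_mixed_comms1; apply: mixed_commV.
Qed.

(** Pad with the trivial commutator. *)
Lemma prod_of_mixed_comms_leq x m n : (m <= n)%N ->
  prod_of_mixed_comms N x m -> prod_of_mixed_comms N x n.
Proof.
move=> /subnKC <-; move: (n - m)%N => {}n Px; elim: n => [|n IH].
  by rewrite addn0.
rewrite addnS -addn1 -(mulg1 x); apply: prod_of_mixed_commsM => //.
exact: prod_of_mixed_comms1 mixed_comm1.
Qed.

Lemma prod_of_mixed_comms_normal x n : prod_of_mixed_comms N x n -> N x.
Proof.
move: x n; apply: prod_of_mixed_comms_ind => [|x y n Nx IH].
  exact: normal1.
exact/normalM/IH/mixed_comm_normal.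
Qed.

Lemma prod_of_mixed_commsX x m n : prod_of_mixed_comms N x m ->
  prod_of_mixed_comms N (x ^+ n) (m * n).
Proof.
move=> Px; elim: n => [|n IH]; first by rewrite muln0; exact: prod_of_mixed_comms0.
by rewrite mulnS expgS; exact: prod_of_mixed_commsM.
Qed.

Lemma mixed_comm_subgroup_prod x :
  mixed_comm_subgroup N x -> exists n, prod_of_mixed_comms N x n.
Proof.
pose H : set G := [set x | exists n, prod_of_mixed_comms N x n].
have closedH : group_closed [in H].
  split=> [|u v /set_mem[m Pu] /set_mem[n Pv]]; apply/mem_set.
    by exists 0%N; exact: prod_of_mixed_comms0.
  exists (m + n)%N; apply: prod_of_mixed_commsM => //.
  exact: prod_of_mixed_commsV.
suff: mixed_comm_subgroup N `<=` H by apply.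
apply: smallest_sub => // y Ny.
by exists 1%N; exact: prod_of_mixed_comms1.
Qed.

End MixedCommutators.

(** * Gluing triangles *)

Section Words.
Context {G : groupType} {N : set G} (hN : normal_subgroup N).
Local Open Scope group_scope.

Local Notation letter := (G * bool)%type.
Local Notation word := (seq letter).
Local Notation letters := (@flatten letter).

(** The sign stays formal because [basis1 g^-1] is not the opposite of [basis1 g]: letters cancel by
    label and sign, not by value. *)
Definition letter_val (l : letter) : G := if l.2 then l.1 else l.1^-1.
Definition word_val (w : word) : G := \prod_(l <- w) letter_val l.
Definition word_in (w : word) : Prop := forall l, l \in w -> N l.1.

Lemma word_val_nil : word_val [::] = 1.
Proof. exact: big_nil. Qed.

Lemma word_val_cons l w : word_val (l :: w) = letter_val l * word_val w.
Proof. exact: big_cons. Qed.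

Lemma word_val_cat v w : word_val (v ++ w) = word_val v * word_val w.
Proof. exact: big_cat. Qed.

Definition word_valE :=
  (word_val_cat, word_val_cons, word_val_nil, @mulg1 G, @mul1g G).

Lemma word_in_perm v w : perm_eq v w -> word_in v -> word_in w.
Proof. by move=> /perm_mem vw Nv l; rewrite -vw; apply: Nv. Qed.

Lemma word_perm_size (v w : word) : perm_eq v w -> size v = size w.
Proof. exact: perm_size. Qed.

Lemma word_in_cat v w : word_in (v ++ w) <-> word_in v /\ word_in w.
Proof.
split=> [Nvw|[Nv Nw] l]; last by rewrite mem_cat => /orP[/Nv|/Nw].
by split=> l lv; apply: Nvw; rewrite mem_cat lv ?orbT.
Qed.

Lemma word_in_cons l w : word_in (l :: w) <-> N l.1 /\ word_in w.
Proof.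
split=> [Nw|[Nl Nw] k]; last by rewrite inE => /predU1P[->|/Nw].
by split=> [|k kw]; apply: Nw; rewrite inE ?eqxx ?kw ?orbT.
Qed.

Lemma word_val_in w : word_in w -> N (word_val w).
Proof.
elim: w => [_|[u b] w IH /word_in_cons[Nu /IH Nw]].
  by rewrite word_valE; exact: normal1 hN.
rewrite word_valE; apply: normalM => //; rewrite /letter_val; case: b Nu => //= Nu.
exact: normalV.
Qed.

(* A list of words stands for the boundary circles of a surface; the product of
   their values is only defined up to a choice of conjugating paths. *)
Inductive conj_prod : seq word -> G -> Prop :=
| conj_prod_nil : conj_prod [::] 1
| conj_prod_cons g w ws t : conj_prod ws t ->
    conj_prod (w :: ws) (g * word_val w * g^-1 * t).

Lemma conj_prod_consE w ws t : conj_prod (w :: ws) t ->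
  exists g s, conj_prod ws s /\ t = g * word_val w * g^-1 * s.
Proof. by move=> P; inversion P as [|g w' ws' s Ps]; exists g, s. Qed.

Lemma conj_prodJ h ws t : conj_prod ws t -> conj_prod ws (h * t * h^-1).
Proof.
elim=> [|g w {}ws {}t _ IH]; first by gnorm; exact: conj_prod_nil.
have -> : h * (g * word_val w * g^-1 * t) * h^-1 =
  h * g * word_val w * (h * g)^-1 * (h * t * h^-1) by gnorm.
exact: conj_prod_cons.
Qed.

Lemma conj_prod_cat vs ws s t : conj_prod vs s -> conj_prod ws t ->
  conj_prod (vs ++ ws) (s * t).
Proof.
move=> Ps Pt; elim: Ps => [|g w {}vs {}s _ IH]; first by rewrite mul1g.
by rewrite -mulgA; exact: conj_prod_cons.
Qed.

(** A conjugated factor passes over its left neighbour by absorbing it into its conjugator. *)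
Lemma conj_prod_front vs w ws t :
  conj_prod (vs ++ w :: ws) t -> conj_prod (w :: vs ++ ws) t.
Proof.
elim: vs t => [//|v vs IH] t /conj_prod_consE[g [s [/IH Ps ->]]].
have [h [r [Pr ->]]] := conj_prod_consE Ps.
set k := g * word_val v * g^-1.
have -> : k * (h * word_val w * h^-1 * r) =
  (k * h) * word_val w * (k * h)^-1 * (k * r) by gnorm.
exact/conj_prod_cons/conj_prod_cons.
Qed.

Lemma conj_prod_rot v w ws t :
  conj_prod ((v ++ w) :: ws) t -> conj_prod ((w ++ v) :: ws) t.
Proof.
move=> /conj_prod_consE[g [s [Ps ->]]].
have -> : g * word_val (v ++ w) * g^-1 =
  (g * word_val v) * word_val (w ++ v) * (g * word_val v)^-1.
  by rewrite !word_valE; gnorm.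
exact: conj_prod_cons.
Qed.

(** Prepares a gluing along [l]: reordering and rotating circles brings [l] to the very front
    without changing [t]. *)
Lemma conj_prod_extract l ws : l \in letters ws ->
  exists (w : word) (vs : seq word), [/\ perm_eq (letters ws) (l :: w ++ letters vs),
    size ws = (size vs).+1 &
    forall t, conj_prod ws t -> conj_prod ((l :: w) :: vs) t].
Proof.
move=> /flattenP[x /path.splitPr[vs1 vs2]] /path.splitPr[v1 v2].
exists (v2 ++ v1), (vs1 ++ vs2); split.
- rewrite !flatten_cat /= -cat1s; apply/permP => p.
  by rewrite !count_cat /= !count_cat /=; lia.
- by rewrite !size_cat /= addnS.
- by move=> t /conj_prod_front/conj_prod_rot.
Qed.

(** Gluing two edges of one circle cuts it in two. No commutator is spent, as [u] is absorbed into
    the conjugator of [v]. *)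
Lemma conj_prod_split u v w ws t :
  conj_prod (((u, true) :: v ++ (u, false) :: w) :: ws) t ->
  conj_prod (v :: w :: ws) t.
Proof.
move=> /conj_prod_consE[g [s [Ps ->]]].
have -> : g * word_val ((u, true) :: v ++ (u, false) :: w) * g^-1 * s =
  (g * u) * word_val v * (g * u)^-1 * (g * word_val w * g^-1 * s).
  by rewrite !word_valE /letter_val /=; gnorm.
exact/conj_prod_cons/conj_prod_cons.
Qed.

(* A band joining two boundary circles of one surface creates a handle. *)
Lemma conj_prod_join u v w ws t : N u -> word_in w ->
  conj_prod (((u, true) :: v) :: ((u, false) :: w) :: ws) t ->
  exists y s, [/\ mixed_comm N y, conj_prod ((w ++ v) :: ws) s & t = y * s].
Proof.
move=> Nu Nw /conj_prod_consE[g [s1 [/conj_prod_consE[h [s [Ps ->]]] ->]]].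
(* With [u = y n], [t] becomes [g y n q n^-1 h^-1 s]. Exchanging [n] and [q] costs their commutator,
   mixed since [n] lies in [N], and leaves [g y x g^-1 s] because [q h^-1 = x g^-1]. *)
set x := word_val v; set y := word_val w; set q := x * g^-1 * h.
set n := y^-1 * u.
have Nn : N n by apply: normalM => //; apply/normalV/word_val_in.
exists (g * y * (n * q * n^-1 * q^-1) * (g * y)^-1).
exists (g * word_val (w ++ v) * g^-1 * s); split.
- by apply: mixed_commJ => //; apply: mixed_comm_swap.
- exact: conj_prod_cons.
- by rewrite /n /q !word_valE /letter_val /= -/x -/y; gnorm.
Qed.

(* [component ws K] holds when the circles [ws] bound a connected surface with
   [c] handles that can be triangulated with at most [K] triangles: by Euler
   characteristic this takes [size (letters ws) + 2 * size ws + 4 * c - 4]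
   of them. *)
Definition component (ws : seq word) (K : nat) : Prop :=
  exists c t, [/\ conj_prod ws t, prod_of_mixed_comms N t c &
    (size (letters ws) + 2 * size ws + 4 * c <= K + 4)%N].

(** Gluing two distinct surfaces along an edge creates no handle. Two letters and one circle
    disappear, which lowers the Euler count by 4 and makes up for adding the constant 4 twice. *)
Lemma component_merge u vs ws K L :
  component vs K -> component ws L ->
  (u, true) \in letters vs -> (u, false) \in letters ws ->
  exists xs : seq word, component xs (K + L) /\
    perm_eq (letters vs ++ letters ws) ((u, true) :: (u, false) :: letters xs).
Proof.
move=> [c [s [Ps cs leK]]] [d [t [Pt dt leL]]].
move=> /conj_prod_extract[v [vs' [pv sv /(_ _ Ps) Pv]]].
move=> /conj_prod_extract[w [ws' [pw sw /(_ _ Pt) Pw]]].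
exists ((w ++ v) :: ws' ++ vs'); split; last first.
  apply/permP => p; move/permP/(_ p): pv; move/permP/(_ p): pw.
  by rewrite /= !count_cat /= !flatten_cat !count_cat; lia.
have [g [a [Pa es]]] := conj_prod_consE Pv.
have [h [b [Pb et]]] := conj_prod_consE Pw.
pose x := word_val v; pose y := word_val w.
(* The conjugators are chosen so that the conjugate of [t] ends in [u^-1] and that of [s] begins
   with [u]. *)
exists (d + c)%N, ((u * h^-1 * t * (u * h^-1)^-1) * (g^-1 * s * g^-1^-1)).
split; last first.
- move/word_perm_size: pv; move/word_perm_size: pw; rewrite /= !size_cat !flatten_cat.
  rewrite sw in leL; rewrite sv in leK; rewrite !size_cat; lia.
- by apply: prod_of_mixed_commsM; apply: prod_of_mixed_commsJ.
have -> : (u * h^-1 * t * (u * h^-1)^-1) * (g^-1 * s * g^-1^-1) =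
  1 * word_val (w ++ v) * 1^-1 *
  ((x^-1 * h^-1 * b * (x^-1 * h^-1)^-1) * (g^-1 * a * g^-1^-1)).
  by rewrite es et !word_valE /letter_val /= -/x -/y; gnorm.
by apply: conj_prod_cons; apply: conj_prod_cat; apply: conj_prodJ.
Qed.

(** Two letters disappear. If they share a circle, it splits and the number of circles grows by one;
    otherwise two circles become one and a handle appears. The Euler count is unchanged in both
    cases. *)
Lemma component_reduce u ws K : component ws K -> word_in (letters ws) ->
  (u, true) \in letters ws -> (u, false) \in letters ws ->
  exists xs : seq word, component xs K /\
    perm_eq (letters ws) ((u, true) :: (u, false) :: letters xs).
Proof.
move=> [c [t [Pt ct leK]]] Nws.
move=> /conj_prod_extract[v [vs [pv sv /(_ _ Pt) Pv]]].
have /word_in_cons[Nu Nvs] := word_in_perm pv Nws.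
rewrite (perm_mem pv) inE xpair_eqE andbF /= mem_cat => /orP[uv|].
  case/path.splitPr: uv => [v1 v2] in pv Pv Nvs *.
  exists (v1 :: v2 :: vs); split; last first.
    apply: (perm_trans pv); apply/permP => p.
    by rewrite /= !count_cat /= ?count_cat; lia.
  exists c, t; split=> //; first exact: conj_prod_split Pv.
  by move/word_perm_size: pv; rewrite /= !size_cat /= ?size_cat; lia.
move=> /conj_prod_extract[w [xs [pw sw Pw]]].
have /conj_prod_consE[g [s [/Pw Ps et]]] := Pv.
have Pws : conj_prod (((u, true) :: v) :: ((u, false) :: w) :: xs) t.
  by rewrite et; apply: conj_prod_cons.
have Nw : word_in w.
  have /word_in_cat[_ /(word_in_perm pw)] := Nvs.
  by case/word_in_cons => _ /word_in_cat[].
have [y [r [Ny Pr etr]]] := conj_prod_join Nu Nw Pws.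
exists ((w ++ v) :: xs); split; last first.
  apply: (perm_trans pv); apply/permP => p; move/permP/(_ p): pw.
  by rewrite /= !count_cat /= ?count_cat; lia.
exists c.+1, r; split=> //.
  have -> : r = y^-1 * t by rewrite etr; gnorm.
  rewrite -add1n; apply: prod_of_mixed_commsM ct.
  exact/prod_of_mixed_comms1/mixed_commV.
by move/word_perm_size: pv; move/word_perm_size: pw; rewrite /= !size_cat /=; lia.
Qed.

Lemma word_val_const y w : (forall l, l \in w -> l = (y, true)) ->
  word_val w = y ^+ size w.
Proof.
elim: w => [_|l w IH yw]; first by rewrite word_valE.
rewrite word_valE expgS IH; last by move=> k kw; apply: yw; rewrite inE kw orbT.
by rewrite (yw l) ?mem_head.
Qed.

(** Each circle is a conjugate of a power [z] of [y]; removing the conjugator [g] costs the single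
    commutator [[g, z]], mixed since [z] lies in [N]. *)
Lemma conj_prod_const y ws t : N y ->
  (forall l, l \in letters ws -> l = (y, true)) -> conj_prod ws t ->
  exists p, prod_of_mixed_comms N p (size (letters ws)) /\
    t = p * y ^+ size (letters ws).
Proof.
move=> Ny yws Pt; elim: Pt yws => [|g w {}ws {}t _ IH] yws.
  by exists 1; split; [exact: prod_of_mixed_comms0 | rewrite mulg1].
have [|p [Pp ->]] := IH; first by move=> l lws; apply: yws; rewrite mem_cat lws orbT.
have yw : word_val w = y ^+ size w.
  by apply: word_val_const => l lw; apply: yws; rewrite mem_cat lw.
rewrite /= size_cat expgnDr yw; set z := y ^+ size w.
exists (comm g z * (z * p * z^-1)); split; last by rewrite /comm; gnorm.
have Nz : N z by apply: normalX.
(* An empty circle has no letter to pay for a commutator, but its value 1 requires none. *)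
case: (posnP (size w)) => [w0|w_gt0].
  have -> : z = 1 by rewrite /z w0.
  by rewrite w0 /comm; gnorm.
apply: (@prod_of_mixed_comms_leq _ _ hN _ (1 + size (letters ws))).
  by rewrite leq_add2r.
apply: prod_of_mixed_commsM; last exact: prod_of_mixed_commsJ.
by apply: prod_of_mixed_comms1; exists g, z.
Qed.

Lemma component_const y ws K : N y -> component ws K ->
  (forall l, l \in letters ws -> l = (y, true)) ->
  exists q, prod_of_mixed_comms N (y ^+ size (letters ws)) q /\
    (4 * q <= K + 8 * size (letters ws))%N.
Proof.
move=> Ny [c [t [Pt ct leK]]] yws; have [p [Pp et]] := conj_prod_const Ny yws Pt.
set m := size (letters ws) in Pp et leK *.
(* A closed surface is discarded together with its handles. Otherwise [m >= 1], and [8 * m] absorbs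
   both the constant 4 of the Euler count and the [m] commutators that straighten the circles. *)
case: (posnP m) => [-> |m_gt0].
  by exists 0%N; split=> //; exact: prod_of_mixed_comms0.
exists (m + c)%N; split; last by lia.
have -> : y ^+ m = p^-1 * t by rewrite et; gnorm.
by apply: prod_of_mixed_commsM => //; apply: prod_of_mixed_commsV.
Qed.

(** * Gluing along edges in [N] *)

Definition component_letters (C : seq (seq word * nat)) : word :=
  letters [seq letters p.1 | p <- C].

Lemma component_letters_cons ws K C :
  component_letters ((ws, K) :: C) = letters ws ++ component_letters C.
Proof. by []. Qed.

Lemma component_letters_cat B C :
  component_letters (B ++ C) = component_letters B ++ component_letters C.
Proof. by rewrite /component_letters map_cat flatten_cat. Qed.

(** The last hypothesis says that the letters sum to [M] times [y] as a chain. Induction on the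
    number of components plus letters: every gluing removes two letters, and a component with
    nothing left to glue is split off with its share of [M]. *)
Lemma components_bound y M (C : seq (seq word * nat)) : N y ->
  (forall p, p \in C -> component p.1 p.2) -> word_in (component_letters C) ->
  (forall g, count_mem (g, true) (component_letters C) =
    count_mem (g, false) (component_letters C) + (g == y) * M)%N ->
  exists q, prod_of_mixed_comms N (y ^+ M) q /\
    (4 * q <= \sum_(p <- C) p.2 + 8 * M)%N.
Proof.
move=> Ny; have [n] := ubnP (size C + size (component_letters C)).
elim: n C M => // n IH [|[ws K] C] M lt_n compC NC chainC.
  have -> : M = 0%N by have := chainC y; rewrite eqxx /=; lia.
  by exists 0%N; split=> //; exact: prod_of_mixed_comms0.
have compws : component ws K by apply: (compC (ws, K)); rewrite mem_head.
have compC' p : p \in C -> component p.1 p.2.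
  by move=> pC; apply: compC; rewrite inE pC orbT.
rewrite big_cons /=; set L := letters ws.
set LC := component_letters C.
have eL : component_letters ((ws, K) :: C) = L ++ LC by [].
rewrite eL in lt_n NC chainC.
have /word_in_cat[NL NLC] := NC.
(* Opposite letters cancel inside the first component or by merging it with
   another one; when none is left, the first component only carries [y]. *)
have [[u [b [uL uC]]]|noC] := pselect
    (exists u b, (u, b) \in L /\ (u, ~~ b) \in L ++ LC).
  have [uL'|uL'] := boolP ((u, ~~ b) \in L).
    have [|| xs [cxs pxs]] := @component_reduce u ws K compws NL.
    - by case: b uL uL' {uC}.
    - by case: b uL uL' {uC}.
    rewrite -/L in pxs.
    have [||||q [Pq le_q]] := IH ((xs, K) :: C) M.
    - move: lt_n; rewrite component_letters_cons -/LC /= !size_cat.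
      by rewrite (word_perm_size pxs) /=; lia.
    - by move=> p; rewrite inE => /predU1P[->//|/compC'].
    - apply/word_in_cat; split=> //.
      by have /word_in_cons[_ /word_in_cons[]] := word_in_perm pxs NL.
    - move=> g; have := chainC g; rewrite component_letters_cons -/LC.
      rewrite !count_cat !(permP pxs) /=.
      by rewrite !xpair_eqE ?eqxx ?andbF ?andbT; lia.
    by exists q; split=> //; move: le_q; rewrite big_cons.
  move: uC; rewrite mem_cat (negPf uL') /= => /flattenP[w /mapP[[xs k] xC ->]] /= ux.
  case/path.splitPr: xC => [C1 C2] in compC' LC lt_n NC chainC eL NLC compC *.
  have cxs : component xs k.
    by apply: (compC' (xs, k)); rewrite mem_cat mem_head orbT.
  have [zs [czs pzs]] : exists zs, component zs (K + k) /\
      perm_eq (L ++ letters xs) ((u, true) :: (u, false) :: letters zs).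
    case: b uL ux {uL'} => uL ux; first exact: component_merge.
    have [zs [czs pzs]] := component_merge cxs compws ux uL.
    by exists zs; split; [rewrite addnC | rewrite perm_catC].
  have eLC : LC = component_letters C1 ++ letters xs ++ component_letters C2.
    by rewrite /LC component_letters_cat.
  have pL : perm_eq (L ++ LC)
      ((u, true) :: (u, false) :: letters zs ++ component_letters (C1 ++ C2)).
    rewrite eLC component_letters_cat; apply/permP => p; move/permP/(_ p): pzs.
    by rewrite /= !count_cat; lia.
  have [||||q [Pq le_q]] := IH ((zs, (K + k)%N) :: C1 ++ C2) M.
  - move: lt_n; rewrite component_letters_cons (word_perm_size pL).
    by rewrite /= !size_cat /=; lia.
  - move=> p; rewrite inE => /predU1P[->//|]; rewrite mem_cat => pC; apply: compC'.
    by rewrite mem_cat inE orbCA pC orbT.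
  - by have /word_in_cons[_ /word_in_cons[]] := word_in_perm pL NC.
  - move=> g; have := chainC g; rewrite !(permP pL) /=.
    by rewrite !xpair_eqE ?eqxx ?andbF ?andbT component_letters_cons; lia.
  exists q; split=> //; move: le_q.
  by rewrite big_cons !big_cat /= big_cons /=; lia.
have LC_opp u b : (u, b) \in L -> count_mem (u, ~~ b) (L ++ LC) = 0%N.
  by move=> uL; apply/count_memPn/negP => uLC; apply: noC; exists u, b.
(* A letter without opposite occurs in excess, which the chain condition allows only for
   [(y, true)]. *)
have Ly l : l \in L -> l = (y, true).
  case: l => u b uL; have := chainC u; have := LC_opp u b uL.
  have : (0 < count_mem (u, b) (L ++ LC))%N.
    by rewrite -has_count has_pred1 mem_cat uL.
  by case: b {uL} => /=; case: eqP => [->//|_]; lia.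
have [q1 [P1 le1]] := component_const Ny compws Ly.
have eLt : count_mem (y, true) L = size L.
  by apply/eqP; rewrite -all_count; apply/allP => l /Ly->; rewrite /= eqxx.
have neL g b : (g, b) != (y, true) -> count_mem (g, b) L = 0%N.
  by move=> ne; apply/count_memPn/negP => /Ly/eqP; rewrite (negPf ne).
have le_M : (size L <= M)%N.
  have [->//|L_gt0] := posnP (size L).
  have yL : (y, true) \in L.
    by rewrite -has_pred1 has_count eLt.
  have := chainC y; have := LC_opp _ _ yL; rewrite /= eqxx !count_cat eLt; lia.
have [||||q2 [P2 le2]] := IH C (M - size L)%N => //.
- by move: lt_n; rewrite /= size_cat -/LC; lia.
- move=> g; have := chainC g; rewrite !count_cat -/LC.
  rewrite (neL g false) ?xpair_eqE ?andbF //.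
  have [->|ne] := eqVneq g y; first by rewrite eLt /=; lia.
  by rewrite neL ?xpair_eqE ?(negPf ne) //=; lia.
rewrite -/L in P1 le1.
exists (q1 + q2)%N; split; last by lia.
rewrite -(subnKC le_M) expgnDr; exact: prod_of_mixed_commsM.
Qed.

(** * Gluing along edges outside [N] *)

Local Notation strip := ((G * G) * (word * word))%type.

(* A strip is a chain of mixed triangles glued along edges outside [N]: it
   leads from the edge [s.1.1] to the edge [s.1.2], and [s.2] lists the edges
   in [N] on its two sides. *)
Definition strip_valid (s : strip) : Prop :=
  s.1.2 = word_val s.2.1 * s.1.1 * word_val s.2.2.
Definition strip_starts (S : seq strip) : seq G := [seq s.1.1 | s <- S].
Definition strip_ends (S : seq strip) : seq G := [seq s.1.2 | s <- S].
Definition strip_letters (S : seq strip) : word :=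
  flatten [seq s.2.1 ++ s.2.2 | s <- S].

Lemma strip_letters_cons s S :
  strip_letters (s :: S) = (s.2.1 ++ s.2.2) ++ strip_letters S.
Proof. by []. Qed.

Lemma strip_letters_cat R S :
  strip_letters (R ++ S) = strip_letters R ++ strip_letters S.
Proof. by rewrite /strip_letters map_cat flatten_cat. Qed.

(** The strip is a disc whose end edges join its boundary circle; for a disc the Euler count is
    attained with equality. *)
Lemma strip_close_normal h k v w : strip_valid ((h, k), (v, w)) ->
  component [:: v ++ (h, true) :: w ++ [:: (k, false)]] (size v + size w).
Proof.
rewrite /strip_valid /= => ek.
set x := v ++ _; exists 0%N, 1; split; last first.
- by rewrite /x /= !size_cat /= size_cat /=; lia.
- exact: prod_of_mixed_comms0.
have -> : 1 = 1 * word_val x * 1^-1 * 1 :> G.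
  by rewrite /x !word_valE /letter_val /= ek; gnorm.
exact/conj_prod_cons/conj_prod_nil.
Qed.

(** Identifying the two ends yields an annulus: [h = v h w] says that [v] times the conjugate of [w]
    by [h] is trivial. Equality holds in the Euler count. *)
Lemma strip_close h v w : strip_valid ((h, h), (v, w)) ->
  component [:: v; w] (size v + size w).
Proof.
rewrite /strip_valid /= => eh.
exists 0%N, 1; split; last by rewrite /= !size_cat /=; lia.
  have -> : 1 = 1 * word_val v * 1^-1 * (h * word_val w * h^-1 * 1) :> G.
    by rewrite -[LHS](mulgV h) {1}eh; gnorm.
  exact/conj_prod_cons/conj_prod_cons/conj_prod_nil.
exact: prod_of_mixed_comms0.
Qed.

Lemma strip_normal h k v w : strip_valid ((h, k), (v, w)) ->
  word_in v -> word_in w -> N k -> N h.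
Proof.
rewrite /strip_valid /= => -> /word_val_in Nv /word_val_in Nw.
by move=> /(normal_mulr hN _ Nw)/(normal_mull hN _ Nv).
Qed.

(** A strip has one triangle per side letter, so the bound counts triangles. Each step preserves
    this count and disposes of one strip: it closes to a disc if [h] lies in [N], to an annulus if
    [h = k], and is prolonged by another strip otherwise. *)
Lemma strips_bound y M (S : seq strip) (C : seq (seq word * nat)) : N y ->
  (forall s, s \in S -> strip_valid s) ->
  (forall p, p \in C -> component p.1 p.2) ->
  word_in (strip_letters S ++ component_letters C) ->
  (forall g,
    count_mem g (strip_starts S) +
      count_mem (g, true) (strip_letters S ++ component_letters C) =
    count_mem g (strip_ends S) +
      count_mem (g, false) (strip_letters S ++ component_letters C) +
      (g == y) * M)%N ->
  exists q, prod_of_mixed_comms N (y ^+ M) q /\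
    (4 * q <= size (strip_letters S) + \sum_(p <- C) p.2 + 8 * M)%N.
Proof.
move=> Ny; have [n] := ubnP (size S).
elim: n S C => // n IH [|[[h k] [v w]] S] C lt_n validS compC NL chainS.
  have [|||q [Pq le_q]] := @components_bound y M C Ny; last by exists q.
  - exact: compC.
  - exact: NL.
  - by move=> g; have := chainS g; rewrite /=; lia.
have valid_s : strip_valid ((h, k), (v, w)) by apply: validS; rewrite mem_head.
have ek : k = word_val v * h * word_val w := valid_s.
have validS' s : s \in S -> strip_valid s.
  by move=> sS; apply: validS; rewrite inE sS orbT.
move: NL; rewrite strip_letters_cons /= => NL.
have /word_in_cat[/word_in_cat[/word_in_cat[Nv Nw] NS] NC] := NL.
have [Nh|nNh] := pselect (N h).
  have Nk : N k.
    by rewrite ek; apply: normalM => //; [apply: normalM => //|]; exact: word_val_in.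
  set c := ([:: v ++ (h, true) :: w ++ [:: (k, false)]], (size v + size w)%N).
  have [|||||q [Pq le_q]] := IH S (c :: C) => //.
  - by move=> p; rewrite inE => /predU1P[->|/compC//]; exact: strip_close_normal.
  - rewrite component_letters_cons /= cats0; apply/word_in_cat; split=> //.
    apply/word_in_cat; split=> //; apply/word_in_cat; split=> //.
    apply/word_in_cons; split=> //; apply/word_in_cat; split=> //.
    by apply/word_in_cons; split.
  - move=> g; have := chainS g.
    rewrite strip_letters_cons component_letters_cons /= cats0.
    rewrite !count_cat /= !count_cat /= !xpair_eqE ?eqxx ?andbF ?andbT.
    by lia.
  exists q; split=> //; move: le_q.
  by rewrite big_cons !size_cat /=; lia.
have [ehk|nhk] := eqVneq h k.
  have [|||||q [Pq le_q]] := IH S (([:: v; w], (size v + size w)%N) :: C) => //.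
  - move=> p; rewrite inE => /predU1P[->|/compC//].
    by apply: (@strip_close h); rewrite {2}ehk.
  - rewrite component_letters_cons /= cats0; apply/word_in_cat; split=> //.
    by apply/word_in_cat; split=> //; apply/word_in_cat.
  - move=> g; have := chainS g.
    rewrite strip_letters_cons component_letters_cons /= cats0 ehk.
    by rewrite !count_cat; lia.
  exists q; split=> //; move: le_q.
  by rewrite big_cons !size_cat /=; lia.
have nNk : ~ N k by move=> Nk; apply: nNh; apply: strip_normal valid_s Nv Nw Nk.
have kL b : count_mem (k, b)
    ((v ++ w) ++ strip_letters S ++ component_letters C) = 0%N.
  by apply/count_memPn/negP; rewrite catA => /NL.
(* Being outside [N], [k] is neither [y] nor a letter; being different from [h], it can only be
   balanced in the chain condition as the start of another strip. *)
have : k \in strip_starts S.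
  rewrite -has_pred1 has_count; have := chainS k.
  rewrite strip_letters_cons /= -!catA catA !kL eqxx (negPf nhk).
  have [eky|_] := eqVneq k y; first by rewrite eky in nNk.
  by lia.
move=> /mapP[[[k' l] [v' w']] sS /= ek']; rewrite -{}ek' in sS.
case/path.splitPr: sS => [S1 S2] in validS' chainS lt_n NL NS kL validS *.
have el : l = word_val v' * k * word_val w'.
  apply: (validS' ((k, l), (v', w'))).
  by rewrite mem_cat mem_head orbT.
have eS : perm_eq ((v ++ w) ++ strip_letters (S1 ++ ((k, l), (v', w')) :: S2))
    ((v' ++ v) ++ (w ++ w') ++ strip_letters (S1 ++ S2)).
  apply/permP => p; rewrite !strip_letters_cat strip_letters_cons /= !count_cat.
  by lia.
have [|||||q [Pq le_q]] := IH (((h, l), (v' ++ v, w ++ w')) :: S1 ++ S2) C.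
- by move: lt_n; rewrite /= !size_cat /=; lia.
- move=> s; rewrite inE => /predU1P[->|]; last first.
    by rewrite mem_cat => sS; apply: validS'; rewrite mem_cat inE orbCA sS orbT.
  by rewrite /strip_valid /= !word_valE el ek; gnorm.
- exact: compC.
- rewrite strip_letters_cons; apply: word_in_perm NL.
  by rewrite perm_cat2r -[X in perm_eq _ X]catA.
- move=> g; have := chainS g; move/permP: eS => eS.
  rewrite !strip_letters_cons /= -!catA ![count _ (_ ++ _)]count_cat.
  have := eS (pred1 (g, true)); have := eS (pred1 (g, false)).
  rewrite /strip_starts /strip_ends !map_cat /= !count_cat /=; lia.
exists q; split=> //; move: le_q; move/word_perm_size: eS.
by rewrite strip_letters_cons /= !size_cat; lia.
Qed.

(* The chain [g2 - g1 g2 + g1] of a triangle [(g1, g2)], or its opposite,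
   as a difference of two lists of edges. *)
Definition triangle_pos (t : (G * G) * bool) : seq G :=
  if t.2 then [:: t.1.1; t.1.2] else [:: t.1.1 * t.1.2].
Definition triangle_neg (t : (G * G) * bool) : seq G :=
  if t.2 then [:: t.1.1 * t.1.2] else [:: t.1.1; t.1.2].

(** An edge in [N] becomes the side letter, on the left for [a] and on the right for [b]. The strip
    joins the other factor to the product [a * b], backwards for an opposite triangle. *)
Lemma triangle_strip t : N t.1.1 \/ N t.1.2 ->
  exists s : strip, [/\ strip_valid s, word_in (s.2.1 ++ s.2.2),
    size (s.2.1 ++ s.2.2) = 1%N,
    forall g, count_mem g (triangle_pos t) =
      ((s.1.1 == g) + count_mem (g, true) (s.2.1 ++ s.2.2))%N &
    forall g, count_mem g (triangle_neg t) =
      ((s.1.2 == g) + count_mem (g, false) (s.2.1 ++ s.2.2))%N].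
Proof.
case: t => [[a b] e] /= [Na|Nb].
  exists (if e then ((b, a * b), ([:: (a, true)], [::]))
          else ((a * b, b), ([:: (a, false)], [::]))).
  case: e; split=> //=;
  rewrite ?/strip_valid /= ?word_valE /letter_val /=; gnorm => //.
  - by apply/word_in_cons.
  - by move=> g; rewrite xpair_eqE andbT; lia.
  - by move=> g; rewrite xpair_eqE andbF; lia.
  - by apply/word_in_cons.
  - by move=> g; rewrite xpair_eqE andbF; lia.
  - by move=> g; rewrite xpair_eqE andbT; lia.
exists (if e then ((a, a * b), ([::], [:: (b, true)]))
        else ((a * b, a), ([::], [:: (b, false)]))).
case: e; split=> //=;
  rewrite ?/strip_valid /= ?word_valE /letter_val /=; gnorm => //.
- by apply/word_in_cons.
- by move=> g; rewrite xpair_eqE andbT; lia.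
- by move=> g; rewrite xpair_eqE andbF; lia.
- by apply/word_in_cons.
- by move=> g; rewrite xpair_eqE andbF; lia.
- by move=> g; rewrite xpair_eqE andbT; lia.
Qed.

Lemma triangles_bound y M (T : seq ((G * G) * bool)) : N y ->
  (forall t, t \in T -> N t.1.1 \/ N t.1.2) ->
  (forall g, count_mem g (flatten (map triangle_pos T)) =
    count_mem g (flatten (map triangle_neg T)) + (g == y) * M)%N ->
  exists q, prod_of_mixed_comms N (y ^+ M) q /\ (4 * q <= size T + 8 * M)%N.
Proof.
move=> Ny NT chainT.
have [S [validS NS sizeS posS negS]] : exists S : seq strip,
  [/\ forall s, s \in S -> strip_valid s, word_in (strip_letters S),
    size (strip_letters S) = size T,
    forall g, count_mem g (flatten (map triangle_pos T)) =
      (count_mem g (strip_starts S) + count_mem (g, true) (strip_letters S))%N &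
    forall g, count_mem g (flatten (map triangle_neg T)) =
      (count_mem g (strip_ends S) + count_mem (g, false) (strip_letters S))%N].
  elim: T NT {chainT} => [|t T IH] NT; first by exists [::].
  have [|S [validS NS sizeS posS negS]] := IH.
    by move=> u uT; apply: NT; rewrite inE uT orbT.
  have [|s [valid_s Ns size_s pos_s neg_s]] := @triangle_strip t.
    by apply: NT; rewrite mem_head.
  exists (s :: S); rewrite strip_letters_cons; split.
  - by move=> r; rewrite inE => /predU1P[->|/validS].
  - exact/word_in_cat.
  - by rewrite size_cat size_s sizeS.
  - by move=> g; rewrite /= !count_cat posS pos_s !count_cat addnACA.
  - by move=> g; rewrite /= !count_cat negS neg_s !count_cat addnACA.
have [|||q [Pq le_q]] := @strips_bound y M S [::] Ny validS => //.
- by rewrite cats0.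
- by move=> g; have := chainT g; rewrite cats0 posS negS; lia.
by exists q; split=> //; move: le_q; rewrite big_nil sizeS addn0.
Qed.

End Words.

(** * Subadditive sequences and Diophantine approximation *)

Section RealSequences.
Context {R : realType}.

Lemma cvg_cst_div_nat (c : R) : c / n%:R @[n --> \oo] --> (0 : R).
Proof.
apply/cvgrPdist_lt => e e0; near=> n.
have n0 : 0 < n%:R :> R by rewrite ltr0n; near: n; exists 1%N.
rewrite sub0r normrN normrM normfV (ger0_norm (ltW n0)) ltr_pdivrMr //.
rewrite mulrC -ltr_pdivrMr //; near: n; exact: nbhs_infty_gtr.
Unshelve. all: end_near. Qed.

(** The limit is the infimum of the quotients over [n > 0], hence the bound at every single [n]. *)
Lemma fekete (u : nat -> R) : (forall n, 0 <= u n) ->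
  (forall m n, u (m + n)%N <= u m + u n) ->
  exists s, (forall n, s * n%:R <= u n) /\ u n / n%:R @[n --> \oo] --> s.
Proof.
move=> u0 uD.
pose E := [set u n / n%:R | n in [set n | (0 < n)%N]].
have lbE : lbound E 0 by move=> _ [n _ <-]; rewrite divr_ge0.
have infE n : (0 < n)%N -> inf E <= u n / n%:R.
  by move=> n0; apply: ge_inf; [exists 0 | exists n].
have infn n : inf E * n%:R <= u n.
  case: n => [|n]; first by rewrite mulr0.
  by rewrite -ler_pdivlMr ?ltr0n //; exact: infE.
exists (inf E); split=> //; apply/cvgrPdist_lt => e e0.
have [_ [k k0 <-] ltk] : exists2 r, E r & r < inf E + e / 2.
  by apply: inf_adherent; [lra | split; [exists (u 1%N / 1); exists 1%N | exists 0]].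
(* Bounds [u] at all remainders modulo [k] at once, since the terms are nonnegative. *)
pose c := \sum_(r < k) u r.
have uM m : u (m * k)%N <= m%:R * u k + u 0%N.
  elim: m => [|m IH]; first by rewrite mul0n mul0r add0r.
  rewrite mulSn (le_trans (uD _ _)) // -natr1 mulrDl mul1r.
  by rewrite (addrC _ (u k)) -addrA lerD2l.
have k0R : 0 < k%:R :> R by rewrite ltr0n.
have le_u n : u n <= n%:R * (u k / k%:R) + (u 0%N + c).
  rewrite {1}(divn_eq n k) (le_trans (uD _ _)) // addrA lerD //.
    rewrite (le_trans (uM _)) // lerD2r mulrA ler_pdivlMr // mulrAC.
    by rewrite ler_wpM2r // -natrM ler_nat leq_trunc_div.
  rewrite /c (bigD1 (Ordinal (ltn_pmod n k0))) //= lerDl.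
  by apply: sumr_ge0 => i _.
near=> n.
have n0 : (0 < n)%N by near: n; exists 1%N.
have n0R : 0 < n%:R :> R by rewrite ltr0n.
have small : (u 0%N + c) / n%:R < e / 2.
  rewrite ltr_pdivrMr // mulrC -ltr_pdivrMr; last lra.
  by near: n; exact: nbhs_infty_gtr.
have lower := infE n n0.
have upper : u n / n%:R <= u k / k%:R + (u 0%N + c) / n%:R.
  rewrite ler_pdivrMr // mulrDl -!mulrA mulVf ?gt_eqF // mulr1.
  by rewrite (mulrC _ n%:R) (mulrCA _ n%:R); exact: le_u.
rewrite distrC ger0_norm ?subr_ge0 //; lra.
Unshelve. all: end_near. Qed.

(* Simultaneous Dirichlet approximation, by the pigeonhole principle. *)
Lemma simultaneous_approximation (I : eqType) (s : seq I) (a : I -> R) (b : nat) :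
  exists M (d : I -> int), (0 < M)%N /\
    forall i, i \in s -> `|(d i)%:~R - M%:R * a i| < b.+1%:R^-1.
Proof.
pose frac j i : R := j%:R * a i - (Num.floor (j%:R * a i))%:~R.
have frac_itv j i : 0 <= frac j i < 1.
  by have /andP[] := floor_itv (j%:R * a i); rewrite intrD /frac; lra.
(* Each unit interval is cut into [b.+1] equal pieces. There are [m] boxes for the [m.+1]
   multipliers, so two of these share a box. *)
pose box j := [ffun k : 'I_(size s) =>
  inord (Num.truncn (b.+1%:R * frac j (tnth (in_tuple s) k))) : 'I_b.+1].
pose m := (b.+1 ^ size s)%N.
have /injectivePn[j [k jk ejk]] : ~~ injectiveb (fun j : 'I_m.+1 => box j).
  apply/negP => /injectiveP/leq_card.
  by rewrite card_ffun !card_ord ltnn.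
wlog lt_jk : j k jk ejk / (j < k)%N.
  move: (jk); rewrite neq_ltn => /orP[lt|lt] gen; first exact: gen lt.
  by apply: (gen k j) => //; rewrite eq_sym.
exists (k - j)%N, (fun i => Num.floor (k%:R * a i) - Num.floor (j%:R * a i)).
split=> [|i si]; first by rewrite subn_gt0.
have -> : (Num.floor (k%:R * a i) - Num.floor (j%:R * a i))%:~R -
    (k - j)%:R * a i = frac j i - frac k i.
  by rewrite natrB 1?ltnW // intrB /frac; ring.
have b0 : 0 < b.+1%:R :> R by rewrite ltr0n.
have si' : (index i s < size s)%N by rewrite index_mem.
(* Fractional parts are below 1, so [inord] never falls back on its default. *)
have boxE l : Num.truncn (b.+1%:R * frac l i) = box l (Ordinal si') :> nat.
  rewrite ffunE (tnth_nth i) /= nth_index // inordK //.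
  have /andP[f0 f1] := frac_itv l i.
  by rewrite truncn_lt_nat ?mulr_ge0 // gtr_pMr.
have /andP[j0 j1] : (Num.truncn (b.+1%:R * frac j i))%:R <= b.+1%:R * frac j i
    < (Num.truncn (b.+1%:R * frac j i)).+1%:R.
  by apply: truncn_itv; rewrite mulr_ge0 //; case/andP: (frac_itv j i).
have /andP[k0 k1] : (Num.truncn (b.+1%:R * frac k i))%:R <= b.+1%:R * frac k i
    < (Num.truncn (b.+1%:R * frac k i)).+1%:R.
  by apply: truncn_itv; rewrite mulr_ge0 //; case/andP: (frac_itv k i).
rewrite boxE ejk -boxE in j0 j1; set n := Num.truncn _ in j0 j1 k0 k1.
rewrite -[n.+1%:R]natr1 in j1 k1.
rewrite -[_^-1]mul1r ltr_pdivlMr // -(ger0_norm (ltW b0)) -normrM.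
by rewrite mulrC mulrBr ltr_norml; lra.
Qed.

End RealSequences.

(** * Chains *)

Section Chains.
Context {R : realType} {G : groupType} (N : set G) (hN : normal_subgroup N).

Local Notation chain1 := (malg G R).
Local Notation chain2 := (malg (G * G)%type R).

(** Allows sums over the supports of several chains to be compared termwise on a common finite
    set. *)
Lemma sum_msupp (V : nmodType) (f : G * G -> R -> V) (c : chain2)
    (D : {fset G * G}) : (forall p, f p 0 = 0) -> (msupp c `<=` D)%fset ->
  \sum_(p <- msupp c) f p (mcoeff p c) = \sum_(p <- D) f p (mcoeff p c).
Proof.
move=> f0 cD; apply: big_fset_incl => // p _ pc.
by rewrite mcoeff_outdom // f0.
Qed.

Lemma boundaryZD (r : R) (b c : chain2) :
  boundary (r *: b + c) = r *: boundary b + boundary c.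
Proof.
pose f (p : G * G) (x : R) : chain1 :=
  x *: (basis1 p.2 - basis1 (p.1 * p.2)%g + basis1 p.1).
have f0 p : f p 0 = 0 by rewrite /f scale0r.
pose D := (msupp b `|` msupp c `|` msupp (r *: b + c))%fset.
have bE x : (msupp x `<=` D)%fset -> boundary x = \sum_(p <- D) f p (mcoeff p x).
  exact: (@sum_msupp _ f).
rewrite !bE; last 3 first.
- by apply/fsubsetP => p; rewrite !inE => ->; rewrite ?orbT.
- by apply/fsubsetP => p; rewrite !inE => ->; rewrite ?orbT.
- by apply/fsubsetP => p; rewrite !inE => ->; rewrite ?orbT.
rewrite scaler_sumr -big_split /=; apply: eq_bigr => p _.
by rewrite /f mcoeffD mcoeffZ scalerDl scalerA.
Qed.

Lemma norm1ZD (r : R) (b c : chain2) :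
  norm1 (r *: b + c) <= `|r| * norm1 b + norm1 c.
Proof.
pose f (p : G * G) (x : R) := `|x|.
have f0 p : f p 0 = 0 by rewrite /f normr0.
pose D := (msupp b `|` msupp c `|` msupp (r *: b + c))%fset.
have bE x : (msupp x `<=` D)%fset -> norm1 x = \sum_(p <- D) f p (mcoeff p x).
  exact: (@sum_msupp _ f).
rewrite !bE; last 3 first.
- by apply/fsubsetP => p; rewrite !inE => ->; rewrite ?orbT.
- by apply/fsubsetP => p; rewrite !inE => ->; rewrite ?orbT.
- by apply/fsubsetP => p; rewrite !inE => ->; rewrite ?orbT.
rewrite mulr_sumr -big_split /=; apply: ler_sum => p _.
by rewrite /f mcoeffD mcoeffZ -normrM ler_normD.
Qed.

Lemma norm1_ge0 (c : chain2) : 0 <= norm1 c.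
Proof. by apply: sumr_ge0 => p _. Qed.

Lemma mcoeff_boundary (c : chain2) g :
  mcoeff g (boundary c) = \sum_(p <- msupp c) mcoeff p c *
    ((p.2 == g)%:R - ((p.1 * p.2)%g == g)%:R + (p.1 == g)%:R).
Proof.
rewrite raddf_sum; apply: eq_bigr => p _.
by rewrite /= mcoeffZ mcoeffD mcoeffB /basis1 !mcoeffU.
Qed.

Lemma mixed_chain2_closed (r : R) (b c : chain2) :
  mixed_chain2 N b -> mixed_chain2 N c -> mixed_chain2 N (r *: b + c).
Proof.
move=> Nb Nc W WP; have [[_ linW] _] := WP.
apply/set_mem/linW; apply/mem_set; first exact: Nb.
exact: Nc.
Qed.

Lemma mixed_chain2_supp (c : chain2) : mixed_chain2 N c ->
  forall p, p \in msupp c -> N p.1 \/ N p.2.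
Proof.
pose W : set chain2 := [set c | forall p, p \in msupp c -> N p.1 \/ N p.2].
have closedW : GRing.submod_closed [in W].
  split=> [|r a b /set_mem Wa /set_mem Wb]; apply/mem_set => p.
    by rewrite msupp0 in_fset0.
  rewrite -mcoeff_neq0 mcoeffD mcoeffZ.
  have [pa|] := boolP (p \in msupp a); first by move=> _; exact: Wa.
  have [pb|] := boolP (p \in msupp b); first by move=> _ _; exact: Wb.
  by move=> /mcoeff_outdom-> /mcoeff_outdom->; rewrite mulr0 addr0 eqxx.
suff: mixed_chain2 N `<=` W by apply.
apply: smallest_sub => // _ [g1 [g2 [Ng ->]]] p.
by rewrite msuppU oner_eq0 in_fset1 => /eqP->.
Qed.

(** * Explicit fillings and upper bounds for the norm *)

Definition fillable (b : chain1) (r : R) : Prop :=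
  exists c, [/\ mixed_chain2 N c, boundary c = b & norm1 c <= r].

Lemma fillable_triangle g1 g2 : N g1 \/ N g2 ->
  fillable (basis1 g2 - basis1 (g1 * g2)%g + basis1 g1) 1.
Proof.
move=> Ng; exists (basis2 g1 g2); split.
- by move=> W [_]; apply; exists g1, g2.
- by rewrite /boundary msuppU oner_eq0 big_seq_fset1 mcoeffUU scale1r.
- by rewrite /norm1 msuppU oner_eq0 big_seq_fset1 mcoeffUU normr1.
Qed.

Lemma fillableZD (k r s : R) a b : fillable a r -> fillable b s ->
  fillable (k *: a + b) (`|k| * r + s).
Proof.
move=> [c [Nc <- leK]] [d [Nd <- leL]]; exists (k *: c + d); split.
- exact: mixed_chain2_closed.
- exact: boundaryZD.
- by rewrite (le_trans (norm1ZD _ _ _)) // lerD // ler_wpM2l.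
Qed.

Lemma fillableD r s a b : fillable a r -> fillable b s ->
  fillable (a + b) (r + s).
Proof. by move=> /(fillableZD 1)/[apply]; rewrite scale1r normr1 mul1r. Qed.

Lemma fillableB r s a b : fillable a r -> fillable b s ->
  fillable (a - b) (r + s).
Proof.
move=> fa /(fillableZD (-1))/(_ fa).
by rewrite scaleN1r normrN normr1 mul1r addrC [s + r]addrC.
Qed.

(** A one-holed torus: the triangles [(z, h)] and [(k, g)] minus [(g, h)]. They are mixed through
    [h], [k] and [h]. *)
Lemma fillable_mixed_comm y : mixed_comm N y -> fillable (basis1 y) 3.
Proof.
move=> [g [h [Nh ->]]]; set z := comm g h; set k := (g * h * g^-1)%g.
have zh : (z * h = k)%g by rewrite /z /comm mulgVK.
have kg : (k * g = g * h)%g by rewrite /k mulgVK.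
have Nk : N k by exact: normalJ.
have := fillableB (fillableD (fillable_triangle (or_intror Nh : N z \/ N h))
  (fillable_triangle (or_introl Nk : N k \/ N g)))
  (fillable_triangle (or_intror Nh : N g \/ N h)).
rewrite zh kg; have -> : 1 + 1 + 1 = 3 :> R by ring.
suff -> : basis1 h - basis1 k + basis1 z + (basis1 g - basis1 (g * h)%g + basis1 k)
  - (basis1 h - basis1 (g * h)%g + basis1 g) = basis1 z :> chain1 by [].
apply/malgP => l; rewrite !(mcoeffD, mcoeffB); ring.
Qed.

(** Each commutator costs three triangles and a fourth to multiply it on; the extra 1 is the
    triangle [(1, 1)] filling the empty product. *)
Lemma fillable_prod y n : prod_of_mixed_comms N y n ->
  fillable (basis1 y) (4 * n%:R + 1).
Proof.
move: y n; apply: prod_of_mixed_comms_ind => [|y z n Ny fz].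
  have := fillable_triangle (or_introl (normal1 hN) : N 1%g \/ N 1%g).
  by rewrite mulg1 subrr add0r mulr0 add0r.
have := fillableB (fillableD (fillable_mixed_comm Ny) fz)
  (fillable_triangle (or_introl (mixed_comm_normal hN Ny) : N y \/ N z)).
have -> : 3 + (4 * n%:R + 1) + 1 = 4 * n.+1%:R + 1 :> R by rewrite -natr1; ring.
suff -> : basis1 y + basis1 z - (basis1 z - basis1 (y * z)%g + basis1 y) =
  basis1 (y * z)%g :> chain1 by [].
by apply/malgP => l; rewrite !(mcoeffD, mcoeffB); ring.
Qed.

Lemma mixed_norm_le b r : fillable b r -> mixed_norm N b <= r.
Proof.
move=> [c [Nc bc le_r]]; apply: le_trans le_r; apply: ge_inf.
  by exists 0 => _ [d _ <-]; exact: norm1_ge0.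
by exists c.
Qed.

(** Fillability makes the set of norms nonempty, so that [inf] is a true infimum and not a default
    value. *)
Lemma le_mixed_norm b r s : fillable b s ->
  (forall c, mixed_chain2 N c -> boundary c = b -> r <= norm1 c) ->
  r <= mixed_norm N b.
Proof.
move=> [c [Nc bc _]] rle; apply: lb_le_inf; first by exists (norm1 c), c.
by move=> _ [d [Nd bd] <-]; exact: rle.
Qed.

(** * From real to integral fillings *)

Definition signed_triangles (s : seq (G * G)) (d : G * G -> int) :
    seq ((G * G) * bool) :=
  flatten [seq nseq `|d p|%N (p, 0 <= d p) | p <- s].

Lemma size_signed_triangles s d :
  size (signed_triangles s d) = (\sum_(p <- s) `|d p|)%N.
Proof.
elim: s => [|p s IH]; first by rewrite big_nil.
by rewrite big_cons /signed_triangles /= size_cat size_nseq -IH.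
Qed.

Lemma count_signed_triangles s d g :
  (count_mem g (flatten (map triangle_pos (signed_triangles s d))))%:Z -
  (count_mem g (flatten (map triangle_neg (signed_triangles s d))))%:Z =
  \sum_(p <- s) d p *
    ((p.2 == g)%:Z - ((p.1 * p.2)%g == g)%:Z + (p.1 == g)%:Z).
Proof.
have countE (f : (G * G) * bool -> seq G) n t :
    count_mem g (flatten (map f (nseq n t))) = (n * count_mem g (f t))%N.
  by elim: n => //= n IH; rewrite count_cat IH mulSn.
elim: s => [|p s IH]; first by rewrite big_nil.
rewrite big_cons -IH /signed_triangles /= !map_cat !flatten_cat !count_cat.
rewrite !countE /triangle_pos /triangle_neg.
by case: (lerP 0 (d p)) => dp /=; nia.
Qed.

(* Approximating the coefficients of a filling simultaneously by rationals with
   a common denominator [M] well enough makes the error of the boundary,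
   an integral chain, vanish. *)
Lemma integral_filling y (c : chain2) : mixed_chain2 N c ->
  boundary c = basis1 y ->
  exists M (T : seq ((G * G) * bool)), [/\ (0 < M)%N,
    forall t, t \in T -> N t.1.1 \/ N t.1.2,
    forall g, count_mem g (flatten (map triangle_pos T)) =
      (count_mem g (flatten (map triangle_neg T)) + (g == y) * M)%N &
    (size T)%:R <= M%:R * (norm1 c + 1)].
Proof.
move=> Nc bc; pose s : seq (G * G) := enum_fset (msupp c).
(* A triangle has three edges, so a boundary coefficient is off by less than [3 * e] per triangle;
   this precision keeps the total below 1. *)
have [M [d [M0 dM]]] := simultaneous_approximation s (fun p => mcoeff p c)
  (3 * size s).
set e := _^-1 in dM.
have sumle (F : G * G -> R) r : (forall p, p \in s -> F p <= r) ->
    \sum_(p <- s) F p <= r * (size s)%:R.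
  move=> Fr; rewrite big_seq (le_trans (ler_sum _ Fr)) //.
  by rewrite -big_seq big_const_seq count_predT iter_addr_0 mulr_natr.
have e3 : 3 * e * (size s)%:R < 1.
  rewrite /e mulrAC ltr_pdivrMr ?ltr0n // mul1r -natrM ltr_nat.
  by rewrite ltnS leqnn.
have s0 : 0 <= (size s)%:R :> R by [].
exists M, (signed_triangles s d); split=> //.
- move=> t /flattenP[l /mapP[p ps ->]] /nseqP[-> _] /=.
  exact: mixed_chain2_supp Nc p ps.
- move=> g.
  pose tri (p : G * G) : int :=
    (p.2 == g)%:Z - ((p.1 * p.2)%g == g)%:Z + (p.1 == g)%:Z.
  have triR p : (tri p)%:~R =
      (p.2 == g)%:R - ((p.1 * p.2)%g == g)%:R + (p.1 == g)%:R :> R.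
    by rewrite intrD intrB.
  have tri3 p : `|(tri p)%:~R| <= 3 :> R.
    by rewrite -intr_norm (ler_int _ _ 3) /tri; do 3!case: (_ == _).
  have bg : \sum_(p <- s) mcoeff p c * (tri p)%:~R = (y == g)%:R.
    have := mcoeff_boundary c g; rewrite bc mcoeffU => ->.
    by apply: eq_bigr => p _; rewrite triR.
  (* The boundary error at [g]: an integer of absolute value below 1, hence zero. *)
  pose z := \sum_(p <- s) d p * tri p - (M * (y == g))%:Z.
  have zR : z%:~R = \sum_(p <- s) ((d p)%:~R - M%:R * mcoeff p c) * (tri p)%:~R :> R.
    rewrite /z intrB PoszM intrM -[_%:~R in X in _ - _ * X]/((y == g)%:R) -bg.
    rewrite mulr_sumr rmorph_sum -sumrB; apply: eq_bigr => p _.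
    by rewrite /= intrM mulrBl mulrA.
  have z1 : `|z%:~R| < 1 :> R.
    rewrite zR (le_lt_trans _ e3) // (le_trans (ler_norm_sum _ _ _)) //.
    apply: sumle => p /dM ltd; rewrite normrM mulrC.
    by apply: ler_pM => //; exact: ltW.
  have z0 : z = 0 by move: z1; rewrite -intr_norm -[1]/(1%:~R) ltr_int; lia.
  have := count_signed_triangles s d g; rewrite -/tri.
  move: z0; rewrite /z (eq_sym g) mulnC => /eqP; rewrite subr_eq0 => /eqP->.
  lia.
- rewrite size_signed_triangles natr_sum mulrDr mulr1.
  (* The rounding adds less than 1 to the total size, which is at most [M]. *)
  have : \sum_(p <- s) (`|d p|%N%:R - M%:R * `|mcoeff p c|) <= e * (size s)%:R.
    apply: sumle => p /dM ltd; apply: le_trans (ltW ltd).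
    apply: le_trans (lerB_dist _ _).
    by rewrite normrM ger0_norm // natr_absz intr_norm.
  rewrite sumrB -mulr_sumr -/(norm1 c).
  have : 1 <= M%:R :> R by rewrite ler1n.
  by nra.
Qed.

End Chains.

(** * Commutator length and its comparison with the filling norm *)

Section CommutatorLength.
Context {G : groupType} {N : set G} (hN : normal_subgroup N).

Lemma clP x n : prod_of_mixed_comms N x n ->
  prod_of_mixed_comms N x (cl N x) /\ (cl N x <= n)%N.
Proof.
move=> Px; pose P m := `[< prod_of_mixed_comms N x m >].
have [] := @xgetPex _ 0%N [set m | prod_of_mixed_comms N x m /\
    forall k, prod_of_mixed_comms N x k -> (m <= k)%N]; last first.
  by move=> Pcl min_cl; split=> //; exact: min_cl.
have exP : exists m, P m by exists n; apply/asboolP.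
case: (ex_minnP exP) => m /asboolP Pm min_m.
by exists m; split=> // k Pk; apply: min_m; apply/asboolP.
Qed.

Lemma cl_subadditive x m n : mixed_comm_subgroup N x ->
  (cl N (x ^+ (m + n))%g <= cl N (x ^+ m)%g + cl N (x ^+ n)%g)%N.
Proof.
move=> /(mixed_comm_subgroup_prod hN)[k Pk].
have [Pm _] := clP (prod_of_mixed_commsX m Pk).
have [Pn _] := clP (prod_of_mixed_commsX n Pk).
by rewrite expgnDr; have [] := clP (prod_of_mixed_commsM Pm Pn).
Qed.

(** The 9 combines 1 from rounding the coefficients and 8 from the gluing. *)
Lemma cl_le_filling (R : realType) (y : G) (c : malg (G * G)%type R) : N y ->
  mixed_chain2 N c -> boundary c = basis1 y ->
  exists2 M, (0 < M)%N &
    4 * (cl N (y ^+ M)%g)%:R <= M%:R * (norm1 c + 9).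
Proof.
move=> Ny Nc bc; have [M [T [M0 NT chainT leT]]] := integral_filling Nc bc.
have [q [Pq le_q]] := triangles_bound hN Ny NT chainT.
exists M => //; have [_ le_cl] := clP Pq.
have : (4 * cl N (y ^+ M)%g <= size T + 8 * M)%N by lia.
by rewrite -(ler_nat R) natrD !natrM; lra.
Qed.

End CommutatorLength.

Theorem theorem1p4 (R : realType) (G : groupType) (N : set G)
    (hN : normal_subgroup N) (x : G) (hx : mixed_comm_subgroup N x) :
  fill R N x = 4 * scl R N x.
Proof.
have [k Pk] := mixed_comm_subgroup_prod hN hx.
have Nx := prod_of_mixed_comms_normal hN Pk.
have fillX n : fillable N (basis1 (x ^+ n)%g : malg G R)
    (4 * (cl N (x ^+ n)%g)%:R + 1).
  by apply: fillable_prod => //; have [] := clP (prod_of_mixed_commsX n Pk).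
have [s [s_le s_cvg]] : exists s : R,
    (forall n, s * n%:R <= (cl N (x ^+ n)%g)%:R) /\
    (cl N (x ^+ n)%g)%:R / n%:R @[n --> \oo] --> s.
  apply: fekete => // m n.
  by rewrite -natrD ler_nat cl_subadditive.
have -> : scl R N x = s by exact: cvg_lim.
apply: cvg_lim => //.
(* Both additive errors, 9 and 1, are independent of [n] and vanish after division by it. *)
apply: (@squeeze_cvgr _ _ _ _ (fun n => 4 * s - 9 / n%:R) (fun n =>
  4 * ((cl N (x ^+ n)%g)%:R / n%:R) + 1 / n%:R)).
- near=> n; have n0 : 0 < n%:R :> R by rewrite ltr0n; near: n; exists 1%N.
  apply/andP; split; last first.
    rewrite mulrA -mulrDl ler_wpM2r ?invr_ge0 //.
    exact: mixed_norm_le (fillX n).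
  rewrite ler_pdivlMr // mulrBl divfK ?gt_eqF //.
  apply: (le_mixed_norm (fillX n)) => c Nc bc.
  have [M M0 leM] := cl_le_filling hN (normalX hN n Nx) Nc bc.
  have M0R : 0 < M%:R :> R by rewrite ltr0n.
  rewrite lerBlDr -(ler_pM2l M0R) (le_trans _ leM) //.
  (* [M] depends on the filling [c], but it cancels because [s_le] holds at every exponent. *)
  have := s_le (n * M)%N; rewrite natrM expgnA.
  by nra.
- rewrite -[X in _ --> X]subr0; apply: cvgB; first exact: cvg_cst.
  exact: cvg_cst_div_nat.
- rewrite -[X in _ --> X]addr0; apply: cvgD; last exact: cvg_cst_div_nat.
  by apply: cvgMr.
Unshelve. all: end_near. Qed.
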